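(* Let $X$ be a $\mathbb{BC}$-module and let $p : X \to \mathbb{D}$ be a hyperbolic-valued seminorm on $X$. Then $\{x \in X : p(x) <' 1\}$ and $\{x \in X : p(x) \leq' 1\}$ are $\mathbb{BC}$-convex, $\mathbb{BC}$-balanced and $\mathbb{BC}$-absorbing subsets of $X$.
   Context: Bicomplex numbers: $\mathbb{BC} = \{w_1 + j w_2 : w_1, w_2 \in \mathbb{C}(i)\}$, where $\mathbb{C}(i)$ is the field of complex numbers with imaginary unit $i$; it is a commutative ring with $i^2=j^2=-1$, $ij=ji=k$, $k^2=1$. Put $e_1=(1+k)/2$, $e_2=(1-k)/2$, so $e_1^2=e_1$, $e_2^2=e_2$, $e_1e_2=0$, $e_1+e_2=1$. Every $Z\in\mathbb{BC}$ is uniquely $Z=e_1z_1+e_2z_2$ with $z_1,z_2\in\mathbb{C}(i)$. Hyperbolic numbers: $\mathbb{D}=\{\beta_1+k\beta_2:\beta_1,\beta_2\in\mathbb{R}\}=\{e_1\alpha_1+e_2\alpha_2:\alpha_1,\alpha_2\in\mathbb{R}\}\subset\mathbb{BC}$; $\mathbb{D}^+=\{e_1\alpha_1+e_2\alpha_2:\alpha_1,\alpha_2\ge 0\}$. For $\alpha,\gamma\in\mathbb{D}$: $\alpha\leq'\gamma$ means $\gamma-\alpha\in\mathbb{D}^+$; $\alpha<'\gamma$ means $\gamma-\alpha=e_1a+e_2b$ with real $a,b>0$. The hyperbolic modulus is $|e_1z_1+e_2z_2|_k=e_1|z_1|+e_2|z_2|\in\mathbb{D}^+$. A hyperbolic-valued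 ($\mathbb{D}$-valued) seminorm on a $\mathbb{BC}$-module $X$ is a function $p:X\to\mathbb{D}$ with $p(\lambda x)=|\lambda|_k\,p(x)$ and $p(x+y)\leq' p(x)+p(y)$ for all $x,y\in X$, $\lambda\in\mathbb{BC}$. A subset $B\subset X$ is: $\mathbb{BC}$-convex if $\lambda x+(1-\lambda)y\in B$ for all $x,y\in B$ and $\lambda\in\mathbb{D}^+$ with $0\leq'\lambda\leq'1$; $\mathbb{BC}$-balanced if $\lambda x\in B$ for all $x\in B$ and $\lambda\in\mathbb{BC}$ with $|\lambda|_k\leq'1$; $\mathbb{BC}$-absorbing if for each $x\in X$ there exists $\epsilon\in\mathbb{D}$, $\epsilon>'0$, such that $\lambda x\in B$ whenever $\lambda \in \mathbb{D}$ and $0\leq'\lambda\leq'\epsilon$. *)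

(* Defs.v *)
From HB Require Import structures.
From mathcomp Require Import all_boot all_order all_algebra.
From mathcomp Require Import ring lra.
From mathcomp Require Import classical_sets reals complex.

Set Implicit Arguments.
Unset Strict Implicit.
Unset Printing Implicit Defensive.

Import Order.TTheory GRing.Theory Num.Theory.

Local Open Scope ring_scope.
Local Open Scope classical_set_scope.

(** * The commutative ring of bicomplex numbers *)

(* [BiComplex w1 w2] stands for w1 + j w2, see [bc_wE].  A dedicated record
   is used because [R[i] * R[i]] already carries the product ring structure. *)
Record bicomplex (R : Type) : Type := BiComplex { bc1 : R[i]; bc2 : R[i] }.

Definition pair_of_bc (R : Type) (Z : bicomplex R) := (bc1 Z, bc2 Z).
Definition bc_of_pair (R : Type) (w : R[i] * R[i]) := BiComplex w.1 w.2.
Lemma pair_of_bcK (R : Type) : cancel (@pair_of_bc R) (@bc_of_pair R).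
Proof. by case. Qed.

HB.instance Definition _ (R : realType) :=
  Choice.copy (bicomplex R) (can_type (@pair_of_bcK R)).

Section BicomplexRing.
Variable R : realType.
Implicit Types Z W V : bicomplex R.

Definition bc_add Z W := BiComplex (bc1 Z + bc1 W) (bc2 Z + bc2 W).
Definition bc_opp Z := BiComplex (- bc1 Z) (- bc2 Z).
Definition bc_mul Z W :=
  BiComplex (bc1 Z * bc1 W - bc2 Z * bc2 W) (bc1 Z * bc2 W + bc2 Z * bc1 W).

Lemma bc_addA : associative bc_add.
Proof. by move=> Z W V; rewrite /bc_add /= !addrA. Qed.
Lemma bc_addC : commutative bc_add.
Proof. by move=> Z W; rewrite /bc_add addrC [bc2 Z + _]addrC. Qed.
Lemma bc_add0 : left_id (BiComplex 0 0) bc_add.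
Proof. by case=> a b; rewrite /bc_add /= !add0r. Qed.
Lemma bc_addN : left_inverse (BiComplex 0 0) bc_opp bc_add.
Proof. by move=> Z; rewrite /bc_add /= !addNr. Qed.

HB.instance Definition _ :=
  GRing.isZmodule.Build (bicomplex R) bc_addA bc_addC bc_add0 bc_addN.

Lemma bc_mulA : associative bc_mul.
Proof. by move=> Z W V; rewrite /bc_mul /=; congr BiComplex; ring. Qed.
Lemma bc_mulC : commutative bc_mul.
Proof. by move=> Z W; rewrite /bc_mul /=; congr BiComplex; ring. Qed.
Lemma bc_mul1 : left_id (BiComplex 1 0) bc_mul.
Proof. by case=> a b; rewrite /bc_mul /=; congr BiComplex; ring. Qed.
Lemma bc_mulD : left_distributive bc_mul bc_add.
Proof. by move=> Z W V; rewrite /bc_mul /bc_add /=; congr BiComplex; ring. Qed.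
Lemma bc_oner_neq0 : BiComplex 1 0 != 0 :> bicomplex R.
Proof. by apply/eqP => -[] /eqP; rewrite oner_eq0. Qed.

HB.instance Definition _ := GRing.Zmodule_isComNzRing.Build (bicomplex R)
  bc_mulA bc_mulC bc_mul1 bc_mulD bc_oner_neq0.

End BicomplexRing.

(** * Units, idempotents and idempotent components *)

Section Units.
Variable R : realType.
Implicit Types (w : R[i]) (a b : R) (Z : bicomplex R).

Definition bcC w : bicomplex R := BiComplex w 0.
Definition bcR a : bicomplex R := bcC a%:C%C.

Definition bcI : bicomplex R := bcC 'i%C.
Definition bcJ : bicomplex R := BiComplex 0 1.
Definition bcK : bicomplex R := bcI * bcJ.
Definition bcE1 : bicomplex R := bcR 2^-1 * (1 + bcK).
Definition bcE2 : bicomplex R := bcR 2^-1 * (1 - bcK).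

(* The components z1, z2 of Z = e1 z1 + e2 z2: as j = - i k and k = e1 - e2,
   w1 + j w2 = e1 (w1 - i w2) + e2 (w1 + i w2); see [bc_idemE] and
   [bc_idem_uniq]. *)
Definition idem1 Z : R[i] := bc1 Z - 'i%C * bc2 Z.
Definition idem2 Z : R[i] := bc1 Z + 'i%C * bc2 Z.

Lemma bcP Z Z' : bc1 Z = bc1 Z' -> bc2 Z = bc2 Z' -> Z = Z'.
Proof. by case: Z Z' => [? ?] [? ?] /= -> ->. Qed.

Lemma bc1D Z Z' : bc1 (Z + Z') = bc1 Z + bc1 Z'. Proof. by []. Qed.
Lemma bc2D Z Z' : bc2 (Z + Z') = bc2 Z + bc2 Z'. Proof. by []. Qed.
Lemma bc1N Z : bc1 (- Z) = - bc1 Z. Proof. by []. Qed.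
Lemma bc2N Z : bc2 (- Z) = - bc2 Z. Proof. by []. Qed.
Lemma bc1M Z Z' : bc1 (Z * Z') = bc1 Z * bc1 Z' - bc2 Z * bc2 Z'.
Proof. by []. Qed.
Lemma bc2M Z Z' : bc2 (Z * Z') = bc1 Z * bc2 Z' + bc2 Z * bc1 Z'.
Proof. by []. Qed.
Definition bcE := (bc1D, bc2D, bc1N, bc2N, bc1M, bc2M).

Lemma bc_wE Z : Z = bcC (bc1 Z) + bcJ * bcC (bc2 Z).
Proof. by apply: bcP; rewrite !bcE /=; ring. Qed.

Lemma sqr_iC : 'i%C * 'i%C = -1 :> R[i].
Proof. by rewrite -expr2 sqr_i. Qed.

Lemma bcIM : bcI * bcI = -1.
Proof. by apply: bcP; rewrite !bcE /= ?sqr_iC; ring. Qed.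
Lemma bcJM : bcJ * bcJ = -1.
Proof. by apply: bcP; rewrite !bcE /=; ring. Qed.
Lemma bcKE : bcK = BiComplex 0 'i%C.
Proof. by apply: bcP; rewrite !bcE /=; ring. Qed.
Lemma bcKM : bcK * bcK = 1.
Proof. by rewrite bcKE; apply: bcP; rewrite !bcE /= ?sqr_iC; ring. Qed.

Lemma idem1D Z Z' : idem1 (Z + Z') = idem1 Z + idem1 Z'.
Proof. by rewrite /idem1 !bcE; ring. Qed.
Lemma idem2D Z Z' : idem2 (Z + Z') = idem2 Z + idem2 Z'.
Proof. by rewrite /idem2 !bcE; ring. Qed.
Lemma idem1M Z Z' : idem1 (Z * Z') = idem1 Z * idem1 Z'.
Proof.
rewrite /idem1 !bcE.
rewrite [RHS](_ : _ = bc1 Z * bc1 Z' + 'i%C * 'i%C * (bc2 Z * bc2 Z')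
   - 'i%C * (bc1 Z * bc2 Z' + bc2 Z * bc1 Z')); last by ring.
by rewrite sqr_iC; ring.
Qed.
Lemma idem2M Z Z' : idem2 (Z * Z') = idem2 Z * idem2 Z'.
Proof.
rewrite /idem2 !bcE.
rewrite [RHS](_ : _ = bc1 Z * bc1 Z' + 'i%C * 'i%C * (bc2 Z * bc2 Z')
   + 'i%C * (bc1 Z * bc2 Z' + bc2 Z * bc1 Z')); last by ring.
by rewrite sqr_iC; ring.
Qed.

Lemma idem1C w : idem1 (bcC w) = w. Proof. by rewrite /idem1 /=; ring. Qed.
Lemma idem2C w : idem2 (bcC w) = w. Proof. by rewrite /idem2 /=; ring. Qed.

Lemma idem_inj Z Z' : idem1 Z = idem1 Z' -> idem2 Z = idem2 Z' -> Z = Z'.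
Proof.
rewrite /idem1 /idem2 => h1 h2.
have two : (2 : R[i]) != 0 by rewrite pnatr_eq0.
have i0 : 'i%C != 0 :> R[i].
  apply/eqP => i0; move: sqr_iC; rewrite i0 mul0r => /eqP.
  by rewrite eq_sym oppr_eq0 oner_eq0.
apply: bcP.
  apply: (mulfI two).
  have -> : 2 * bc1 Z = (bc1 Z - 'i%C * bc2 Z) + (bc1 Z + 'i%C * bc2 Z) by ring.
  by rewrite h1 h2; ring.
apply: (mulfI (mulf_neq0 two i0)).
have -> : 2 * 'i%C * bc2 Z = (bc1 Z + 'i%C * bc2 Z) - (bc1 Z - 'i%C * bc2 Z)
  by ring.
by rewrite h1 h2; ring.
Qed.

Lemma half2 : ((2^-1 : R)%:C)%C = 2^-1 :> R[i].
Proof. by rewrite fmorphV rmorph_nat. Qed.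

Lemma idem1K : idem1 bcK = 1.
Proof. by rewrite bcKE /idem1 /= sqr_iC; ring. Qed.
Lemma idem2K : idem2 bcK = -1.
Proof. by rewrite bcKE /idem2 /= sqr_iC; ring. Qed.
Lemma idem1_1 : idem1 1 = 1. Proof. exact: (idem1C 1). Qed.
Lemma idem2_1 : idem2 1 = 1. Proof. exact: (idem2C 1). Qed.
Lemma idem1N Z : idem1 (- Z) = - idem1 Z.
Proof. by rewrite /idem1 !bcE; ring. Qed.
Lemma idem2N Z : idem2 (- Z) = - idem2 Z.
Proof. by rewrite /idem2 !bcE; ring. Qed.

Lemma idem1E1 : idem1 bcE1 = 1.
Proof. by rewrite idem1M idem1D idem1K idem1_1 idem1C half2; field. Qed.
Lemma idem1E2 : idem1 bcE2 = 0.
Proof. by rewrite idem1M idem1D idem1N idem1K idem1_1 subrr mulr0. Qed.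
Lemma idem2E1 : idem2 bcE1 = 0.
Proof. by rewrite idem2M idem2D idem2K idem2_1 subrr mulr0. Qed.
Lemma idem2E2 : idem2 bcE2 = 1.
Proof. by rewrite idem2M idem2D idem2N idem2K idem2_1 idem2C half2; field. Qed.

Definition idemE := (idem1D, idem2D, idem1M, idem2M, idem1N, idem2N, idem1C,
  idem2C, idem1_1, idem2_1, idem1K, idem2K, idem1E1, idem1E2, idem2E1, idem2E2).

Lemma bc_idemE Z : Z = bcE1 * bcC (idem1 Z) + bcE2 * bcC (idem2 Z).
Proof. by apply: idem_inj; rewrite !idemE; ring. Qed.

Lemma bc_idem_uniq Z (z1 z2 : R[i]) :
  Z = bcE1 * bcC z1 + bcE2 * bcC z2 -> z1 = idem1 Z /\ z2 = idem2 Z.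
Proof. by move=> ->; rewrite !idemE; split; ring. Qed.

Lemma bcE1M : bcE1 * bcE1 = bcE1.
Proof. by apply: idem_inj; rewrite !idemE; ring. Qed.
Lemma bcE2M : bcE2 * bcE2 = bcE2.
Proof. by apply: idem_inj; rewrite !idemE; ring. Qed.
Lemma bcE1E2 : bcE1 * bcE2 = 0.
Proof. by apply: idem_inj; rewrite -(subrr 1) !idemE; ring. Qed.
Lemma bcE1DE2 : bcE1 + bcE2 = 1.
Proof. by apply: idem_inj; rewrite !idemE; ring. Qed.

End Units.

Arguments bcI {R}.
Arguments bcJ {R}.
Arguments bcK {R}.
Arguments bcE1 {R}.
Arguments bcE2 {R}.

(** * Hyperbolic numbers *)

Section Hyperbolic.
Variable R : realType.
Implicit Types Z alpha gamma : bicomplex R.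

Definition hyperbolic : set (bicomplex R) :=
  [set Z | exists b1 b2 : R, Z = bcR b1 + bcK * bcR b2].

Definition hyperbolic_ge0 : set (bicomplex R) :=
  [set Z | exists a1 a2 : R,
     [/\ 0 <= a1, 0 <= a2 & Z = bcE1 * bcR a1 + bcE2 * bcR a2]].

(* The two orders are only meant to be used on hyperbolic numbers. *)
Definition hle alpha gamma : Prop := hyperbolic_ge0 (gamma - alpha).

Definition hlt alpha gamma : Prop :=
  exists a b : R,
    [/\ 0 < a, 0 < b & gamma - alpha = bcE1 * bcR a + bcE2 * bcR b].

(* The norm of [R[i]] takes its values in the reals embedded in [R[i]]. *)
Definition hmod Z : bicomplex R :=
  bcE1 * bcC `|idem1 Z| + bcE2 * bcC `|idem2 Z|.

Lemma hyperbolic_idemP Z :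
  hyperbolic Z <-> exists a1 a2 : R, Z = bcE1 * bcR a1 + bcE2 * bcR a2.
Proof.
split=> [[b1 [b2 ->]]|[a1 [a2 ->]]].
  exists (b1 + b2), (b1 - b2).
  by apply: idem_inj; rewrite !idemE ?rmorphD ?rmorphN /=; ring.
exists ((a1 + a2) / 2), ((a1 - a2) / 2).
apply: idem_inj; rewrite !idemE !rmorphM /= !half2 rmorphD rmorphB /=;
  by field.
Qed.

Lemma hmod_ge0 Z : hyperbolic_ge0 (hmod Z).
Proof.
exists (complex.Re `|idem1 Z|), (complex.Re `|idem2 Z|).
have H (w : R[i]) : 0 <= complex.Re `|w| /\ `|w| = ((complex.Re `|w|)%:C)%C.
  by case: w => x y; rewrite normc_def /= sqrtr_ge0.
have [? e1] := H (idem1 Z); have [? e2] := H (idem2 Z).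
by split=> //; rewrite /hmod /bcR -e1 -e2.
Qed.

End Hyperbolic.

Notation "x <=' y" := (hle x y) (at level 70, no associativity) : ring_scope.
Notation "x <' y" := (hlt x y) (at level 70, no associativity) : ring_scope.

(** * Modules over the bicomplex numbers *)

Section Modules.
Variables (R : realType) (X : lmodType (bicomplex R)).

Definition hyperbolic_seminorm (p : X -> bicomplex R) : Prop :=
  [/\ forall x, hyperbolic (p x),
      forall (l : bicomplex R) x, p (l *: x) = hmod l * p x
    & forall x y, p (x + y) <=' p x + p y].

Definition bc_convex (B : set X) : Prop :=
  forall x y, B x -> B y ->
  forall l, hyperbolic_ge0 l -> 0 <=' l -> l <=' 1 ->
    B (l *: x + (1 - l) *: y).

Definition bc_balanced (B : set X) : Prop :=
  forall x, B x -> forall l : bicomplex R, hmod l <=' 1 -> B (l *: x).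

Definition bc_absorbing (B : set X) : Prop :=
  forall x, exists e, [/\ hyperbolic e, 0 <' e &
    forall l, hyperbolic l -> 0 <=' l -> l <=' e -> B (l *: x)].

End Modules.

(* Main.v *)
Require Import Defs.
From HB Require Import structures.
From mathcomp Require Import all_boot all_order all_algebra.
From mathcomp Require Import ring.
From mathcomp Require Import classical_sets reals complex.

Import Order.TTheory GRing.Theory Num.Theory.

Local Open Scope ring_scope.
Local Open Scope classical_set_scope.

(** Everything decouples along the idempotents [bcE1] and [bcE2].  The maps
    [idem1] and [idem2] are ring morphisms from the bicomplex numbers to [R[i]],
    and the partial order of [R[i]], in which [z <= w] forces [w - z] to be
    real, turns the hyperbolic orders into the componentwise orders ([hleP],
    [hltP]).  Hence the two components of a hyperbolic seminorm are seminorms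
    in the ordinary sense, for the action of scalars through [idem1] and
    [idem2] ([seminorm_via]), and a hyperbolic unit ball is the intersection
    of the two unit balls of its components.

    For one component [q] the classical arguments apply.  Subadditivity on
    [x + (- x)] gives [0 <= q x]; a convex combination of [q x] and [q y] is at
    most the larger of the two; [`|l| * q x <= q x] when [`|l| <= 1]; and
    [t * q x < 1] when [0 <= t <= (1 + q x)^-1].  Each of these bounds compares
    the new value with a value already known to be in the ball, or is strict,
    so the open and the closed balls are treated together, with the boolean of
    [_ < _ ?<= if _] telling which one is meant. *)

(** * Seminorms for the action of scalars through a ring morphism *)

(** A component of a hyperbolic seminorm is homogeneous over the bicomplex
    numbers, but it sees only the image of a scalar under [idem1] or [idem2];
    the morphism [c] stands for either of them. *)
Definition seminorm_via {A : pzRingType} {K : numFieldType} {X : lmodType A}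
    (c : A -> K) (q : X -> K) : Prop :=
  (forall l x, q (l *: x) = `|c l| * q x) /\
  (forall x y, q (x + y) <= q x + q y).

Section SeminormVia.
Context {A : pzRingType} {K : numFieldType} {X : lmodType A}.
Context {c : {rmorphism A -> K}} {q : X -> K} (hq : seminorm_via c q).

Lemma seminorm_via_ge0 (x : X) : 0 <= q x.
Proof.
have [qZ qD] := hq.
have := qD x (-1 *: x).
rewrite scaleN1r subrr -(scale0r x) -scaleN1r !qZ !rmorphN rmorph0 rmorph1.
by rewrite normr0 mul0r normrN normr1 mul1r -mulr2n pmulrn_lge0.
Qed.

(** The larger of [q x] and [q y] makes sense although [K] is only partially
    ordered, since both are nonnegative. *)
Lemma seminorm_via_convex (C : bool) (x y : X) (l : A) :
  0 <= c l -> c l <= 1 -> q x < 1 ?<= if C -> q y < 1 ?<= if C ->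
  q (l *: x + (1 - l) *: y) < 1 ?<= if C.
Proof.
have [qZ qD] := hq => l_ge0 l_le1 qx_lt1 qy_lt1.
have l'_ge0 : 0 <= 1 - c l by rewrite subr_ge0.
have q_le : q (l *: x + (1 - l) *: y) <= c l * q x + (1 - c l) * q y.
  by apply: le_trans (qD _ _) _; rewrite !qZ rmorphB rmorph1 !ger0_norm.
have lteif_via (m : K) :
    q x <= m -> q y <= m -> m < 1 ?<= if C ->
    q (l *: x + (1 - l) *: y) < 1 ?<= if C.
  move=> qx_le qy_le; apply: (lteif_trans (C1 := true)).
  apply: le_trans q_le _.
  have -> : m = c l * m + (1 - c l) * m by ring.
  by apply: lerD; apply: ler_wpM2l.
have := real_leVge (ger0_real (seminorm_via_ge0 x))
                   (ger0_real (seminorm_via_ge0 y)).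
by case/orP => le_q; [apply: (lteif_via (q y)) | apply: (lteif_via (q x))].
Qed.

Lemma seminorm_via_balanced (C : bool) (x : X) (l : A) :
  `|c l| <= 1 -> q x < 1 ?<= if C -> q (l *: x) < 1 ?<= if C.
Proof.
move=> l_le1; apply: (lteif_trans (C1 := true)).
by rewrite /= hq.1 ler_piMl ?seminorm_via_ge0.
Qed.

(** Adding 1 to [q x] keeps the radius finite when [q x = 0] and makes the
    bound strict, so that one radius serves both balls. *)
Lemma seminorm_via_absorbing (x : X) (l : A) :
  0 <= c l -> c l <= (1 + q x)^-1 -> q (l *: x) < 1.
Proof.
move=> l_ge0 l_le; rewrite hq.1 ger0_norm //.
have q_ge0 := seminorm_via_ge0 x.
have q1_gt0 : 0 < 1 + q x by rewrite ltr_pwDl.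
apply: le_lt_trans (ler_wpM2r q_ge0 l_le) _.
by rewrite mulrC ltr_pdivrMr // mul1r ltrDr ltr01.
Qed.

End SeminormVia.

(** * Hyperbolic numbers by components *)

Section Components.
Context {R : realType}.
Implicit Types Z W : bicomplex R.

Lemma idem1B : zmod_morphism (@idem1 R).
Proof. by move=> Z W; rewrite !idemE. Qed.
Lemma idem2B : zmod_morphism (@idem2 R).
Proof. by move=> Z W; rewrite !idemE. Qed.
Lemma idem1_monoid : monoid_morphism (@idem1 R).
Proof. by split=> [|Z W]; rewrite !idemE. Qed.
Lemma idem2_monoid : monoid_morphism (@idem2 R).
Proof. by split=> [|Z W]; rewrite !idemE. Qed.

HB.instance Definition _ :=
  GRing.isZmodMorphism.Build (bicomplex R) R[i] (@idem1 R) idem1B.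
HB.instance Definition _ :=
  GRing.isZmodMorphism.Build (bicomplex R) R[i] (@idem2 R) idem2B.
HB.instance Definition _ :=
  GRing.isMonoidMorphism.Build (bicomplex R) R[i] (@idem1 R) idem1_monoid.
HB.instance Definition _ :=
  GRing.isMonoidMorphism.Build (bicomplex R) R[i] (@idem2 R) idem2_monoid.

Definition bc_of_idem (z w : R[i]) : bicomplex R :=
  bcE1 * bcC z + bcE2 * bcC w.

Lemma idem1_of_idem z w : idem1 (bc_of_idem z w) = z.
Proof. by rewrite !idemE; ring. Qed.
Lemma idem2_of_idem z w : idem2 (bc_of_idem z w) = w.
Proof. by rewrite !idemE; ring. Qed.

Lemma idem1_hmod Z : idem1 (hmod Z) = `|idem1 Z|.
Proof. exact: idem1_of_idem. Qed.
Lemma idem2_hmod Z : idem2 (hmod Z) = `|idem2 Z|.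
Proof. exact: idem2_of_idem. Qed.

(** A nonnegative element of [R[i]] is real, so the real coefficients that
    [hle] asks for can be read off as the real parts of the components. *)
Lemma hleP Z W : Z <=' W <-> idem1 Z <= idem1 W /\ idem2 Z <= idem2 W.
Proof.
rewrite -[idem1 Z <= _]subr_ge0 -[idem2 Z <= _]subr_ge0 -idem1B -idem2B.
split=> [[a [b [a_ge0 b_ge0 ->]]]|[z_ge0 w_ge0]].
  by rewrite idem1_of_idem idem2_of_idem !lecR.
exists (complex.Re (idem1 (W - Z))), (complex.Re (idem2 (W - Z))).
rewrite -!lecR /bcR !RRe_real ?ger0_real //; split=> //.
exact: bc_idemE.
Qed.

Lemma hltP Z W : Z <' W <-> idem1 Z < idem1 W /\ idem2 Z < idem2 W.
Proof.
rewrite -[idem1 Z < _]subr_gt0 -[idem2 Z < _]subr_gt0 -idem1B -idem2B.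
split=> [[a [b [a_gt0 b_gt0 ->]]]|[z_gt0 w_gt0]].
  by rewrite idem1_of_idem idem2_of_idem !ltcR.
exists (complex.Re (idem1 (W - Z))), (complex.Re (idem2 (W - Z))).
rewrite -!ltcR /bcR !RRe_real ?gtr0_real //; split=> //.
exact: bc_idemE.
Qed.

Lemma hyperbolic_of_idem (z w : R[i]) :
  z \is Num.real -> w \is Num.real -> hyperbolic (bc_of_idem z w).
Proof.
move=> z_real w_real; apply/hyperbolic_idemP.
by exists (complex.Re z), (complex.Re w); rewrite /bcR !RRe_real.
Qed.

Definition hlteif (C : bool) Z W : Prop := if C then Z <=' W else Z <' W.

Lemma hlteifP C Z W : hlteif C Z W <->
  idem1 Z < idem1 W ?<= if C /\ idem2 Z < idem2 W ?<= if C.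
Proof. by case: C; [apply: hleP | apply: hltP]. Qed.

End Components.

(** * Unit balls of a hyperbolic seminorm *)

Section UnitBalls.
Context {R : realType} {X : lmodType (bicomplex R)} {p : X -> bicomplex R}.
Hypothesis hp : hyperbolic_seminorm p.

Lemma seminorm_idem1 : seminorm_via (@idem1 R) (@idem1 R \o p).
Proof.
have [_ pZ pD] := hp; split=> [l x|x y] /=.
  by rewrite pZ idem1M idem1_hmod.
by have /hleP[] := pD x y; rewrite idem1D.
Qed.

Lemma seminorm_idem2 : seminorm_via (@idem2 R) (@idem2 R \o p).
Proof.
have [_ pZ pD] := hp; split=> [l x|x y] /=.
  by rewrite pZ idem2M idem2_hmod.
by have /hleP[] := pD x y; rewrite idem2D.
Qed.

Lemma unit_ball_convex C : bc_convex [set x : X | hlteif C (p x) 1].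
Proof.
move=> x y /hlteifP[px1 px2] /hlteifP[py1 py2] l _ /hleP[l1_ge0 l2_ge0].
move=> /hleP[l1_le1 l2_le1]; apply/hlteifP.
move: l1_ge0 l2_ge0 l1_le1 l2_le1 px1 px2 py1 py2.
rewrite !rmorph0 !rmorph1 => l1_ge0 l2_ge0 l1_le1 l2_le1 px1 px2 py1 py2.
split; first exact: (seminorm_via_convex seminorm_idem1).
exact: (seminorm_via_convex seminorm_idem2).
Qed.

Lemma unit_ball_balanced C : bc_balanced [set x : X | hlteif C (p x) 1].
Proof.
move=> x /hlteifP[px1 px2] l /hleP[]; rewrite idem1_hmod idem2_hmod.
move: px1 px2; rewrite !rmorph1 => px1 px2 l1_le1 l2_le1.
apply/hlteifP; rewrite !rmorph1.
split; first exact: (seminorm_via_balanced seminorm_idem1).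
exact: (seminorm_via_balanced seminorm_idem2).
Qed.

Lemma unit_ball_absorbing C : bc_absorbing [set x : X | hlteif C (p x) 1].
Proof.
move=> x.
have r1_gt0 : 0 < (1 + idem1 (p x))^-1.
  by rewrite invr_gt0 ltr_pwDl // (seminorm_via_ge0 seminorm_idem1).
have r2_gt0 : 0 < (1 + idem2 (p x))^-1.
  by rewrite invr_gt0 ltr_pwDl // (seminorm_via_ge0 seminorm_idem2).
exists (bc_of_idem (1 + idem1 (p x))^-1 (1 + idem2 (p x))^-1); split.
- by apply: hyperbolic_of_idem; apply: gtr0_real.
- by apply/hltP; rewrite idem1_of_idem idem2_of_idem !rmorph0.
- move=> l _ /hleP[]; rewrite !rmorph0 => l1_ge0 l2_ge0 /hleP[].
  rewrite idem1_of_idem idem2_of_idem => l1_le l2_le.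
  apply/hlteifP; rewrite !rmorph1; split; apply: lteifS.
    exact: (seminorm_via_absorbing seminorm_idem1).
  exact: (seminorm_via_absorbing seminorm_idem2).
Qed.

End UnitBalls.

Theorem theorem3p6 (R : realType) (X : lmodType (bicomplex R))
    (p : X -> bicomplex R) (hp : hyperbolic_seminorm p) :
  [/\ bc_convex [set x : X | p x <' 1],
      bc_balanced [set x : X | p x <' 1]
    & bc_absorbing [set x : X | p x <' 1]] /\
  [/\ bc_convex [set x : X | p x <=' 1],
      bc_balanced [set x : X | p x <=' 1]
    & bc_absorbing [set x : X | p x <=' 1]].
Proof.
split; split.
- exact: (unit_ball_convex hp false).
- exact: (unit_ball_balanced hp false).
- exact: (unit_ball_absorbing hp false).
- exact: (unit_ball_convex hp true).
- exact: (unit_ball_balanced hp true).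
- exact: (unit_ball_absorbing hp true).
Qed.
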